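(* For every positive integer $h$ there exists a constant $c(h)$ depending only on $h$ such that the following holds. Let $P$ be a poset of height $h$, let $k$ be a positive integer and $d=2|P|$. If $\mathcal{F}\subset[k]^d$ does not contain an induced copy of $P$, then $|\mathcal{F}|\le |P|^{c(h)}k^{d-1}$.
   Context: $[k]^d=\{1,\dots,k\}^d$ with the coordinatewise partial order. The height of a poset is the size of its largest chain. A subset $P'\subset Q$ is an induced copy of $P$ if there is a bijection $\pi:P\to P'$ with $x\le_P y\iff\pi(x)\le_Q\pi(y)$. *)

(* Defs.v *)
From HB Require Import structures.
From mathcomp Require Import all_boot all_order.
Set Implicit Arguments. Unset Strict Implicit. Unset Printing Implicit Defensive.
Import Order.TTheory.

Definition is_chain (d : Order.disp_t) (P : finPOrderType d) (A : {set P}) : bool :=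
  [forall x in A, forall y in A, (x <= y)%O || (y <= x)%O].

Definition height (d : Order.disp_t) (P : finPOrderType d) : nat :=
  \max_(A : {set P} | is_chain A) #|A|.

(* The grid [k]^dim, with [k] = {1..k} encoded as 'I_k = {0..k-1}. *)
Definition grid (dim k : nat) := {ffun 'I_dim -> 'I_k}.

Definition grid_le (dim k : nat) (f g : grid dim k) : bool :=
  [forall i, (f i <= g i)%N].

Definition has_induced_copy (d : Order.disp_t) (P : finPOrderType d)
    (dim k : nat) (F : {set grid dim k}) : Prop :=
  exists pi : P -> grid dim k,
    [/\ injective pi,
        forall x, pi x \in F
      & forall x y, (x <= y)%O = grid_le (pi x) (pi y)].

(* Main.v *)
Require Import Defs.
From HB Require Import structures.
From mathcomp Require Import all_boot all_order.
From mathcomp Require Import zify.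
Set Implicit Arguments. Unset Strict Implicit. Unset Printing Implicit Defensive.
Import Order.TTheory.

(** Induction in the style of Marcus-Tardos and Klazar-Marcus. Cut the grid into
    blocks of side [s]. If few blocks contain more than [s^(d-1)/2] points of [F],
    pass to the set of nonempty blocks. Otherwise each rich block shatters some set
    [T] of coordinates: every vector of [q = 2h] prescribed values on [T] is attained
    in the block. Fix a [T] that is popular among the rich blocks, fix the block
    coordinates on [T], and find recursively a copy among these blocks in which only
    the coordinates outside [T] matter; inside the blocks, the coordinate of [T]
    assigned to [v] is used to separate [v] from all [w] not above it: an element [u]
    of rank [l] gets value [l] there, raised to [h + l] when [v <= u]. After all
    elements of [P] have been assigned, a strict chain of length [h] is enough.

    For large [n = |P|] the blocks have side [q]; the Sauer-Shelah inequality gives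
    sets [T] of size about [n/(4q)] shattered by a fraction [1/(4q)] of the weight, so
    [8q] rounds suffice and each costs a factor polynomial in [n]. For [n] bounded in
    terms of [h], singletons [T] and one round per element suffice. *)

(** * Shattering *)

Lemma card_ltn_ord (n k : nat) : #|[set v : 'I_n | v < k]| <= k.
Proof.
rewrite -sum1_card (eq_bigl (fun v : 'I_n => v < k)); last by move=> v; rewrite inE.
rewrite -(big_mkord (fun v => v < k) (fun=> 1)) -big_filter sum1_size.
rewrite -[leqRHS](size_iota 0); apply: uniq_leq_size.
  by rewrite filter_uniq // iota_uniq.
by move=> v; rewrite mem_filter mem_iota => /andP[].
Qed.

Lemma sum_subset_setU1 (I : finType) (i : I) (A : {set I}) (f : {set I} -> nat) :
  i \notin A ->
  \sum_(T : {set I} | T \subset i |: A) f T =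
  \sum_(T : {set I} | T \subset A) f T + \sum_(T : {set I} | T \subset A) f (i |: T).
Proof.
move=> iA; rewrite (bigID (fun T : {set I} => i \in T)) /= [LHS]addnC; congr (_ + _).
  apply: eq_bigl => T; apply/andP/idP => [[TA iT]|TA].
    apply/subsetP => j jT; move/subsetP/(_ j jT): TA; rewrite !inE => /orP[/eqP ji|//].
    by rewrite -ji jT in iT.
  split; first exact: subset_trans TA (subsetUr _ _).
  by apply: contra iA => /(subsetP TA).
rewrite (reindex_onto (fun T => i |: T) (fun T => T :\ i)) /=; last first.
  by move=> T /andP[_ iT]; rewrite setD1K.
apply: eq_bigl => T; rewrite setU11 andbT; apply/andP/idP => [[TA /eqP eT]|TA].
  rewrite -eT; apply/subsetP => j; rewrite !inE => /andP[ji].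
  by rewrite (negbTE ji) /= => jT; have := subsetP TA j; rewrite !inE jT orbT (negbTE ji); apply.
have iT : i \notin T by apply: contra iA => /(subsetP TA).
by rewrite setUS // setU1K.
Qed.

Section Families.
Variables (I : finType) (N : nat).
Notation point := {ffun I -> 'I_N.+1}.
Implicit Types (A T : {set I}) (F G B : {set point}) (x y : point) (k : nat) (V : I -> nat -> nat).

(* [A] is the set of active coordinates: removing coordinates from [A], rather than
   from [I], keeps all families in one finite type. *)
Definition fam A k F :=
  (forall x i, x \in F -> i \in A -> x i < k) /\
  (forall x y i, x \in F -> y \in F -> i \notin A -> x i = y i).

Lemma fam_sub A k F G : G \subset F -> fam A k F -> fam A k G.
Proof.
move=> /subsetP GF [h1 h2]; split=> [x i /GF|x y i /GF xF /GF]; first exact: h1.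
exact: h2.
Qed.

Lemma card_box A m F :
  (forall i, i \in A -> #|[set x i | x : point in F]| <= m) ->
  (forall x y i, x \in F -> y \in F -> i \notin A -> x i = y i) ->
  #|F| <= m ^ #|A|.
Proof.
move=> hA hN.
apply: (@leq_trans #|family (fun i => [set x i | x : point in F])|).
  apply/subset_leq_card/subsetP => x xF; apply/familyP => i.
  by apply/imsetP; exists x.
rewrite card_family foldrE big_map big_enum /= -prod_nat_const [leqRHS]big_mkcond /=.
apply: leq_prod => i _; case: ifP => [/hA //|/negbT iA].
apply: (@leq_trans #|[set x i | x : point in F]|) => //.
by apply/card_le1_eqP => _ _ /imsetP[x xF ->] /imsetP[y yF ->]; apply: hN.
Qed.

Lemma fam_card A k F : fam A k F -> #|F| <= k ^ #|A|.
Proof.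
move=> [h1 h2]; apply: card_box => // i iA.
apply: leq_trans (card_ltn_ord N.+1 k); apply/subset_leq_card/subsetP => v.
by case/imsetP=> x xF ->; rewrite inE h1.
Qed.

(* [V i c] is the [c]-th of the [q] values used in coordinate [i]. *)
Definition shatters (q : nat) (B : {set point}) (T : {set I}) V : bool :=
  [forall g : {ffun I -> 'I_q}, [exists x in B, [forall i in T, val (x i) == V i (g i)]]].

Lemma shattersP (q : nat) B T V :
  reflect (forall g : {ffun I -> 'I_q}, exists2 x, x \in B & forall i, i \in T -> x i = V i (g i) :> nat)
          (shatters q B T V).
Proof.
apply: (iffP forallP) => h g.
  by have /exists_inP[x xB /forall_inP hx] := h g; exists x => // i iT; apply/eqP/hx.
have [x xB hx] := h g; apply/exists_inP; exists x => //; apply/forall_inP => i iT.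
by apply/eqP/hx.
Qed.

Lemma shatters_sub (q : nat) B T T' V : T' \subset T -> shatters q B T V -> shatters q B T' V.
Proof.
move=> /subsetP TT /shattersP h; apply/shattersP => g.
by have [x xB hx] := h g; exists x => // i /TT; apply: hx.
Qed.

Definition zero_at (i : I) x : point := [ffun j => if j == i then ord0 else x j].

(* Pajor's form: split off a coordinate [i], and compare [B] with its projection
   [B0] and the set [B1] of points of [B0] whose fibre is full. *)
Lemma sauer_shelah A m B : fam A m.+1 B ->
  #|B| <= \sum_(T : {set I} | T \subset A)
            shatters m.+1 B T (fun=> id) * m ^ (#|A| - #|T|).
Proof.
move: {2}#|A| (erefl #|A|) => a; elim: a A B => [|a IH] A B.
  move/eqP; rewrite cards_eq0 => /eqP-> hB.
  have := fam_card hB; rewrite cards0 expn0 => B1.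
  have [->|[x xB]] := set_0Vmem B; first by rewrite cards0.
  apply: leq_trans B1 _; rewrite (bigD1 set0) //= cards0 expn0 muln1.
  suff -> : shatters m.+1 B set0 (fun=> id) by [].
  by apply/shattersP => g; exists x => // i; rewrite inE.
move=> cA [h1 h2].
have [i iA] : exists i, i \in A by apply/set0Pn; rewrite -cards_eq0 cA.
pose A' := A :\ i.
have cA' : #|A'| = a by have := cardsD1 i A; rewrite iA cA => -[].
have iA' : i \notin A' by rewrite !inE eqxx.
pose B0 := [set zero_at i x | x in B].
pose B1 := [set y in B0 | [forall c : 'I_m.+1, [exists z in B, (zero_at i z == y) && (val (z i) == c)]]].
have hB0 : fam A' m.+1 B0.
  split=> [_ j /imsetP[x xB ->]|_ _ j /imsetP[x xB ->] /imsetP[y yB ->]].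
    by rewrite !inE ffunE => /andP[/negbTE-> jA]; apply: h1.
  by rewrite !inE negb_and negbK !ffunE; case: eqP => //= _; apply: h2.
have hB1 : fam A' m.+1 B1 by apply: fam_sub hB0; apply/subsetP => y; rewrite inE => /andP[].
(* A fibre over [B0] takes at most [m.+1] values in coordinate [i], and at most [m] unless all of
   them occur, which is membership in [B1]. *)
have cB : #|B| <= m * #|B0| + #|B1|.
  rewrite -sum1_card (partition_big_imset (zero_at i)) /= -/B0.
  have -> : #|B1| = \sum_(y in B0) (y \in B1).
    rewrite -sum1_card [LHS]big_mkcond [RHS]big_mkcond /=; apply: eq_bigr => y _.
    by rewrite inE; case: (y \in B0) => //=; case: ifP.
  rewrite mulnC -sum_nat_const -big_split /=; apply: leq_sum => y yB0.
  rewrite sum1dep_card.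
  set S := [set x | _].
  have inj : {in S &, injective (fun z : point => z i)}.
    move=> u v; rewrite !inE => /andP[_ /eqP cu] /andP[_ /eqP cv] uv.
    apply/ffunP => j; have [->//|ji] := eqVneq j i.
    by have := congr1 (fun z : point => z j) (etrans cu (esym cv)); rewrite !ffunE (negbTE ji).
  rewrite -(card_in_imset inj).
  have sub : [set z i | z : point in S] \subset [set v : 'I_N.+1 | v < m.+1].
    by apply/subsetP => v /imsetP[z zS ->]; move: zS; rewrite !inE => /andP[zB _]; apply: h1.
  have [yB1|] := boolP (y \in B1).
    by rewrite addn1; apply: leq_trans (subset_leq_card sub) (card_ltn_ord _ _).
  rewrite inE yB0 /= => /forallPn[c /exists_inPn nc]; rewrite addn0.
  have cn v : v \in [set z i | z : point in S] -> v != c :> nat.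
    case/imsetP=> z; rewrite inE => /andP[zB zy] ->; apply/negP => zc.
    by have := nc z zB; rewrite zy zc.
  (* The missing value [c] need not lie in ['I_N.+1]. If it does not, the whole type already has at
     most [m] elements. *)
  have [cN|cN] := leqP N.+1 c.
    have := leq_trans (subset_leq_card (subset_trans sub (subsetT _))) _; apply.
    by rewrite cardsT card_ord; apply: leq_trans cN _; rewrite -ltnS.
  have sub' : [set z i | z : point in S] \subset [set v : 'I_N.+1 | v < m.+1] :\ Ordinal cN.
    by apply/subsetP => v vS; rewrite in_setD1 (subsetP sub) // andbT -val_eqE /= cn.
  apply: leq_trans (subset_leq_card sub') _.
  have := cardsD1 (Ordinal cN) [set v : 'I_N.+1 | v < m.+1].
  rewrite inE /= ltn_ord add1n => e; rewrite -ltnS -e; exact: card_ltn_ord.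
have sh0 T : T \subset A' -> shatters m.+1 B0 T (fun=> id) -> shatters m.+1 B T (fun=> id).
  move=> TA' /shattersP sh; apply/shattersP => g; have [_ /imsetP[x xB ->] hx] := sh g.
  exists x => // j jT; rewrite -hx // ffunE; case: eqP => // ji.
  by move: iA'; rewrite -ji (subsetP TA').
have sh1 T : T \subset A' -> shatters m.+1 B1 T (fun=> id) -> shatters m.+1 B (i |: T) (fun=> id).
  move=> TA' /shattersP sh; apply/shattersP => g; have [y] := sh g.
  rewrite inE => /andP[_ /forallP/(_ (g i))/exists_inP[z zB /andP[/eqP<- /eqP zi]]] hy.
  exists z => // j; rewrite in_setU1 => /orP[/eqP->//|jT]; rewrite -hy // ffunE.
  case: eqP => // ji; by move: iA'; rewrite -ji (subsetP TA').
have -> : \sum_(T : {set I} | T \subset A) shatters m.+1 B T (fun=> id) * m ^ (#|A| - #|T|) =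
   \sum_(T : {set I} | T \subset i |: A') shatters m.+1 B T (fun=> id) * m ^ (#|A| - #|T|).
  by rewrite setD1K.
(* The sets avoiding [i] pay for [m * #|B0|], those containing [i] for [#|B1|]. *)
rewrite sum_subset_setU1 //; apply: leq_trans cB (leq_add _ _).
  apply: leq_trans (leq_mul (leqnn m) (IH _ _ cA' hB0)) _.
  rewrite big_distrr /=; apply: leq_sum => T TA'.
  have -> : #|A| - #|T| = (#|A'| - #|T|).+1.
    by rewrite cA cA' subSn // -cA' subset_leq_card.
  rewrite expnS mulnCA leq_mul //.
  by have := sh0 T TA'; case: shatters => // ->.
apply: leq_trans (IH _ _ cA' hB1) _; apply: leq_sum => T TA'.
have iT : i \notin T by apply: contra iA' => /(subsetP TA').
rewrite cardsU1 iT cA cA' add1n subSS leq_mul //.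
by have := sh1 T TA'; case: shatters => // ->.
Qed.

End Families.

(** * Partial copies and the block recursion *)

Lemma card_le_fibres (S R : finType) (f : S -> R) (G : {set S}) (m : nat) :
  (forall y, y \in f @: G -> #|[set x in G | f x == y]| <= m) -> #|G| <= m * #|f @: G|.
Proof.
move=> hm; rewrite -sum1_card (partition_big_imset f) /= mulnC -sum_nat_const.
by apply: leq_sum => y /hm; rewrite sum1dep_card.
Qed.

(** A Bernoulli-type estimate, [(k + s)^m * (k - m * s) <= k^(m+1)], where [k - m * s] is at least
    [2k/3]. It bounds the loss from rounding the number of blocks up by a factor 3/2. *)
Lemma expn_add_le (k s m : nat) :
  3 * (m * s) <= k -> 0 < k -> 2 * (k + s) ^ m <= 3 * k ^ m.
Proof.
have aux j : j * s <= k -> (k + s) ^ j * (k - j * s) <= k ^ j.+1.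
  elim: j => [|j IH] jk; first by rewrite expn0 mul1n subn0 expn1.
  have jk' : j * s <= k by apply: leq_trans jk; rewrite mulSn leq_addl.
  have key : (k + s) * (k - j.+1 * s) <= (k - j * s) * k.
    rewrite mulSn in jk *; set t := j * s in jk jk' *.
    have -> : k = (k - (s + t)) + s + t by lia.
    move: (k - (s + t)) => z.
    have -> : z + s + t - (s + t) = z by lia.
    have -> : z + s + t - t = z + s by lia.
    nia.
  rewrite expnS mulnAC; apply: leq_trans (leq_mul key (leqnn _)) _.
  by rewrite mulnAC expnSr leq_mul2r mulnC IH // orbT.
move=> mk k0; have mk' : m * s <= k by lia.
have := aux m mk'; rewrite expnS => main.
rewrite -(leq_pmul2l k0); set p := (k + s) ^ m in main *.
have : p * (2 * k) <= p * (3 * (k - m * s)) by rewrite leq_mul2l; apply/orP; right; lia.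
lia.
Qed.

Section Copies.
Variables (I : finType) (N : nat) (d : Order.disp_t) (P : finPOrderType d).
Variables (h : nat) (L : P -> nat).
Hypothesis L_mono : forall u w, (u < w)%O -> L u < L w.
Hypothesis L_lt : forall u, L u < h.

Notation point := {ffun I -> 'I_N.+1}.
Implicit Types (A T : {set I}) (F G B : {set point}) (x y : point).
Implicit Types (k s : nat) (V : I -> nat -> nat) (W : {set P}).

(* Strictness in all active coordinates lets copies be lifted from blocks to points.
   Only the elements of [W] must be separated from those not above them. *)
Definition wcopy A W F := exists phi : P -> point,
  [/\ forall u, phi u \in F,
      forall u w i, (u < w)%O -> i \in A -> phi u i < phi w i
    & forall v w, v \in W -> ~~ (v <= w)%O -> exists2 i, i \in A & phi w i < phi v i].

Definition bounded A W C :=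
  forall k F, fam A k F -> ~ wcopy A W F -> #|F| <= C * k ^ #|A|.-1.

(* Partition by the diagonals: a diagonal with [h] points of [F] carries a strict
   chain, and each diagonal starts where some active coordinate is [0]. *)
Lemma bounded_chain A : 0 < #|A| -> bounded A set0 (h * #|A|).
Proof.
move=> A0 k F hF ncopy; have [h1 h2] := hF.
have [i0 i0A] : exists i, i \in A by apply/set0Pn; rewrite -card_gt0.
pose mn x : nat := x [arg min_(i < i0 in A) (x i : nat)].
have mnle x i : i \in A -> mn x <= x i.
  by rewrite /mn; case: arg_minnP => // j _; apply.
pose D x : point := [ffun i => if i \in A then inord (x i - mn x) else x i].
have DE x i : i \in A -> D x i = x i - mn x :> nat.
  by move=> iA; rewrite ffunE iA inordK //; apply: leq_ltn_trans (leq_subr _ _) (ltn_ord _).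
have cD : #|D @: F| <= #|A| * k ^ #|A|.-1.
  apply: (@leq_trans (\sum_(i in A) #|[set y in D @: F | y i == 0 :> nat]|)).
    have sub : D @: F \subset \bigcup_(i in A) [set y in D @: F | y i == 0 :> nat].
      apply/subsetP => y yF; apply/bigcupP; have /imsetP[x xF e] := yF.
      pose j := [arg min_(i < i0 in A) (x i : nat)].
      have jA : j \in A by rewrite /j; case: arg_minnP.
      by exists j => //; rewrite inE yF e DE //= subnn.
    apply: leq_trans (subset_leq_card sub) _.
    apply: (big_ind2 (fun (U : {set point}) n => #|U| <= n)) => //; first by rewrite cards0.
    move=> U m V n Um Vn; apply: leq_trans (leq_add Um Vn).
    by rewrite -cardsUI leq_addr.
  rewrite -sum_nat_const; apply: leq_sum => i iA.
  have -> : #|A|.-1 = #|A :\ i| by rewrite (cardsD1 i A) iA.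
  apply: (@fam_card _ _ (A :\ i) k); split.
    move=> y j; rewrite inE => /andP[/imsetP[x xF ->] _]; rewrite in_setD1 => /andP[_ jA].
    by rewrite DE //; apply: leq_ltn_trans (leq_subr _ _) (h1 _ _ xF jA).
  move=> y z j; rewrite !inE => /andP[yF /eqP yi] /andP[zF /eqP zi].
  rewrite negb_and negbK => /orP[/eqP->|jA]; first by apply: val_inj; rewrite /= yi zi.
  case/imsetP: yF => x xF ->; case/imsetP: zF => x' x'F ->.
  by rewrite !ffunE (negbTE jA); apply: h2.
rewrite -mulnA; apply: leq_trans (leq_mul (leqnn h) cD).
apply: card_le_fibres => y yF; rewrite leqNgt; apply/negP => big; apply: ncopy.
set S := [set x in F | D x == y] in big.
have coord x i : x \in S -> i \in A -> x i = y i + mn x :> nat.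
  by rewrite inE => /andP[_ /eqP<-] iA; rewrite DE // subnK // mnle.
have inj : {in S &, injective mn}.
  move=> u v uS vS uv; apply/ffunP => i.
  have [iA|iA] := boolP (i \in A); first by apply: val_inj; rewrite /= (coord u) // (coord v) // uv.
  by move: uS vS; rewrite !inE => /andP[uF _] /andP[vF _]; apply: h2.
pose l := sort (fun u v => mn u <= mn v) (enum S).
have lS x : (x \in l) = (x \in S) by rewrite mem_sort mem_enum.
have szl : size l = #|S| by rewrite size_sort -cardE.
have srt : sorted ltn (map mn l).
  rewrite ltn_sorted_uniq_leq map_inj_in_uniq ?sort_uniq ?enum_uniq; last first.
    by move=> u v; rewrite !lS; apply: inj.
  by rewrite sorted_map; apply: sort_sorted => u v; apply: leq_total.
have [x0 x0S] : exists x, x \in S.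
  by apply/set0Pn; rewrite -card_gt0; apply: leq_ltn_trans big.
have Ls u : L u < size l by rewrite szl; apply: leq_trans (L_lt u) (ltnW big).
(* Sorted by [mn], a diagonal increases strictly in every active coordinate, and [L] is a strictly
   monotone index into it. *)
pose phi u := nth x0 l (L u).
have phiS u : phi u \in S by rewrite -lS mem_nth.
exists phi; split=> [u|u w i uw iA|v w]; last by rewrite inE.
  by have := phiS u; rewrite inE => /andP[].
rewrite (coord (phi u)) // (coord (phi w)) // ltn_add2l.
have /(_ (L u) (L w)) := sorted_ltn_nth ltn_trans 0 srt.
by rewrite !inE size_map !Ls !(nth_map x0) //; apply=> //; apply: L_mono.
Qed.

(** Block index and offset are kept in the same type of points, so [fam], [wcopy] and [bounded]
    apply to both. Neither exceeds [x i], so [inord] never truncates. *)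
Definition coarse s x : point := [ffun i => inord (x i %/ s)].
Definition fine s x : point := [ffun i => inord (x i %% s)].

Lemma coarseE s x i : coarse s x i = x i %/ s :> nat.
Proof. by rewrite ffunE inordK // (leq_ltn_trans (leq_div _ _)). Qed.

Lemma fineE s x i : fine s x i = x i %% s :> nat.
Proof. by rewrite ffunE inordK // (leq_ltn_trans (leq_mod _ _)). Qed.

Lemma coarse_fine_inj s x y : coarse s x = coarse s y -> fine s x = fine s y -> x = y.
Proof.
move=> c f; apply/ffunP => i; apply: val_inj => /=.
by rewrite (divn_eq (x i) s) (divn_eq (y i) s) -!coarseE -!fineE c f.
Qed.

Lemma coarse_lt s x y i : coarse s x i < coarse s y i -> x i < y i.
Proof. by rewrite !coarseE; apply: contraTT; rewrite -!leqNgt; apply: leq_div2r. Qed.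

Lemma fine_lt s x y i :
  coarse s x i = coarse s y i -> fine s x i < fine s y i -> x i < y i.
Proof.
move=> /(congr1 val) /=; rewrite !coarseE !fineE => c f.
by rewrite (divn_eq (x i) s) (divn_eq (y i) s) c ltn_add2l.
Qed.

Lemma coarse_fam A s k F : 0 < s -> fam A k F -> fam A (k %/ s).+1 (coarse s @: F).
Proof.
move=> s0 [h1 h2]; split.
  move=> _ i /imsetP[x xF ->] iA; rewrite coarseE ltnS leq_div2r //.
  exact: ltnW (h1 _ _ xF iA).
move=> _ _ i /imsetP[x xF ->] /imsetP[y yF ->] iA.
by apply: val_inj; rewrite /= !coarseE (h2 x y i).
Qed.

Lemma wcopy_coarse A W s F : wcopy A W (coarse s @: F) -> wcopy A W F.
Proof.
case=> psi [psiF mono wit].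
(* Any point of [F] in the block [psi u] will do; the default is never reached. *)
pose phi u := odflt (psi u) [pick x in F | coarse s x == psi u].
have phiP u : phi u \in F /\ coarse s (phi u) = psi u.
  rewrite /phi; case: pickP => [x /andP[xF /eqP]//|no].
  by have /imsetP[x xF e] := psiF u; have := no x; rewrite xF e eqxx.
exists phi; split=> [u|u w i uw iA|v w vW vw]; first by case: (phiP u).
  apply: (@coarse_lt s); have [_ ->] := phiP u; have [_ ->] := phiP w; exact: mono.
have [i iA lt] := wit v w vW vw; exists i => //.
by apply: (@coarse_lt s); have [_ ->] := phiP v; have [_ ->] := phiP w.
Qed.

Definition block s F X := [set fine s x | x in [set x in F | coarse s x == X]].

Lemma block_fam A s k F X : 0 < s -> fam A k F -> fam A s (block s F X).
Proof.
move=> s0 [h1 h2]; split.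
  by move=> _ i /imsetP[x _ ->] _; rewrite fineE ltn_mod.
move=> _ _ i /imsetP[x + ->] /imsetP[y + ->] iA; rewrite !inE => /andP[xF _] /andP[yF _].
by apply: val_inj; rewrite /= !fineE (h2 x y i).
Qed.

Lemma card_block s F X : #|block s F X| = #|[set x in F | coarse s x == X]|.
Proof.
apply: card_in_imset => x y; rewrite !inE => /andP[_ /eqP cx] /andP[_ /eqP cy].
by apply: coarse_fine_inj; rewrite cx.
Qed.

(* [e] assigns to the elements of [W1] coordinates in [T], on which all blocks in [G]
   agree. *)
Lemma wcopy_extend A T W W1 s V (e : P -> I) F G :
  T \subset A ->
  (forall i c c', i \in T -> c < c' < h + h -> V i c < V i c') ->
  (forall v, v \in W1 -> e v \in T) -> {in W1 &, injective e} ->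
  (forall X Y i, X \in G -> Y \in G -> i \in T -> X i = Y i) ->
  (forall X, X \in G -> shatters (h + h) (block s F X) T V) ->
  wcopy (A :\: T) (W :\: W1) G -> wcopy A W F.
Proof.
move=> TA Vmono eT einj agree sh [psi [psiG mono wit]].
(* The elements raised in coordinate [i] form an up-set and all ranks are below [h], so raising them
   by [h] keeps [c i] strictly monotone, with values below [h + h]. *)
pose up i u := [exists v in W1, (e v == i) && (v <= u)%O].
pose c i u := if up i u then h + L u else L u.
have c_lt i u : c i u < h + h by have := L_lt u; rewrite /c; case: ifP => _; lia.
have c_mono i u w : (u < w)%O -> c i u < c i w.
  move=> uw; have := L_mono uw; rewrite /c.
  have : up i u -> up i w.
    case/exists_inP=> v vW /andP[ev vu]; apply/exists_inP; exists v => //.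
    by rewrite ev (le_trans vu (ltW uw)).
  by case: (up i u) => [->//|_]; [lia|case: ifP; lia].
have ex u : [exists x in F, (coarse s x == psi u) &&
                            [forall i in T, val (fine s x i) == V i (c i u)]].
  have /shattersP/(_ [ffun i => Ordinal (c_lt i u)])[y /imsetP[x]] := sh _ (psiG u).
  rewrite inE => /andP[xF xX] -> hx; apply/exists_inP; exists x => //; rewrite xX.
  by apply/forall_inP => i iT; rewrite /= hx // ffunE.
pose phi u := odflt (psi u) [pick x in F | (coarse s x == psi u) &&
                            [forall i in T, val (fine s x i) == V i (c i u)]].
have phiP u : [/\ phi u \in F, coarse s (phi u) = psi u &
               forall i, i \in T -> fine s (phi u) i = V i (c i u) :> nat].
  rewrite /phi; case: pickP => [x /andP[xF /andP[/eqP cx /forall_inP fx]]|no].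
    by split=> // i iT; apply/eqP/fx.
  by have /exists_inP[x xF xP] := ex u; have := no x; rewrite xF xP.
have tieT u w i : i \in T -> coarse s (phi u) i = coarse s (phi w) i.
  by move=> iT; have [_ -> _] := phiP u; have [_ -> _] := phiP w; apply: agree.
have ltT u w i : i \in T -> c i u < c i w -> phi u i < phi w i.
  move=> iT lt; apply: (@fine_lt s); first exact: tieT.
  have [_ _ ->//] := phiP u; have [_ _ ->//] := phiP w.
  by apply: Vmono => //; rewrite lt c_lt.
exists phi; split=> [u|u w i uw iA|v w vW vw]; first by have [] := phiP u.
  have [iT|iT] := boolP (i \in T); first by apply: ltT => //; apply: c_mono.
  apply: (@coarse_lt s); have [_ -> _] := phiP u; have [_ -> _] := phiP w.
  by apply: mono => //; rewrite inE iT.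
have [vW1|vW1] := boolP (v \in W1); last first.
  have [|i iA lt] := wit v w _ vw; first by rewrite inE vW1.
  exists i; first by move: iA; rewrite inE => /andP[].
  by apply: (@coarse_lt s); have [_ -> _] := phiP w; have [_ -> _] := phiP v.
exists (e v); first by apply: (subsetP TA); apply: eT.
apply: ltT; first exact: eT.
have -> : c (e v) v = h + L v.
  by rewrite /c ifT //; apply/exists_inP; exists v => //; rewrite eqxx lexx.
(* By injectivity of [e] only [v] is assigned to this coordinate, and [w] is not above [v], so [w]
   is not raised. *)
have -> : c (e v) w = L w.
  rewrite /c ifF //; apply/negbTE/exists_inPn => v' v'W; apply/negP => /andP[/eqP ev v'w].
  by move: vw; rewrite -(einj v' v) // v'w.
exact: leq_trans (L_lt w) (leq_addr _ _).
Qed.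

(* [Th] indexes the possible kinds of shattering, weighted by [wt]: a rich block
   realises kinds of total weight at least [Om / r], so some kind is realised by a
   fraction [1 / r] of the rich blocks. *)
Lemma bounded_stage A W W1 s r Om C' C (X : finType) (Th : {set X})
    (Tt : X -> {set I}) (Vt : X -> I -> nat -> nat) (wt : X -> nat) :
  1 < s ->
  (forall t, t \in Th -> [/\ Tt t \subset A, #|W1| <= #|Tt t| < #|A|,
     forall i c c', i \in Tt t -> c < c' < h + h -> Vt t i c < Vt t i c'
     & bounded (A :\: Tt t) (W :\: W1) C']) ->
  0 < Om -> \sum_(t in Th) wt t <= Om ->
  (forall B, fam A s B -> s ^ #|A|.-1 < 2 * #|B| ->
     Om <= r * \sum_(t in Th) shatters (h + h) B (Tt t) (Vt t) * wt t) ->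
  0 < #|A| -> 6 * s * r * C' <= C -> 3 * s * #|A| <= C ->
  bounded A W C.
Proof.
move=> s1 hT Om0 sumOm rich A0 C1 C2 k.
have s0 : 0 < s by apply: ltnW.
have [i0 i0A] : exists i, i \in A by apply/set0Pn; rewrite -card_gt0.
set a := #|A| in A0 C2 rich *.
elim/ltn_ind: k => k IH F hF ncopy.
(* For small [k] the trivial bound [k^a] suffices; for larger [k] there are fewer than [k] blocks
   per side and the rounding loss is under control. *)
have [kle|kge] := ltnP k (3 * s * a).
  apply: leq_trans (fam_card hF) _; rewrite -/a -(prednK A0) expnS /=.
  by rewrite leq_mul2r (leq_trans (ltnW kle) C2) orbT.
set F' := coarse s @: F; set K := (k %/ s).+1.
have hF' : fam A K F' by apply: coarse_fam.
have ncopy' : ~ wcopy A W F' by move/wcopy_coarse.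
have k0 : 0 < k by apply: leq_trans kge; rewrite !muln_gt0 /= s0.
have Kk : K < k.
  have : k %/ s <= k %/ 2 by apply: leq_div2l.
  have : 6 <= k by apply: leq_trans kge; nia.
  rewrite /K; lia.
have cF' := IH K Kk F' hF' ncopy'.
pose rch Y := s ^ a.-1 < 2 * #|block s F Y|.
pose G := [set Y in F' | rch Y].
(* Poor blocks hold at most [s^(a-1)/2] points each, rich ones at most [s^a]. *)
have cF : 2 * #|F| <= s ^ a.-1 * #|F'| + 2 * s ^ a * #|G|.
  have -> : #|G| = \sum_(Y in F') (rch Y).
    rewrite -sum1_card [LHS]big_mkcond [RHS]big_mkcond /=; apply: eq_bigr => Y _.
    by rewrite inE; case: (Y \in F') => //=; case: (rch Y).
  rewrite -sum1_card (partition_big_imset (coarse s)) /= -/F' big_distrr /=.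
  rewrite [s ^ _ * _]mulnC -sum_nat_const big_distrr -big_split /=.
  apply: leq_sum => Y _; rewrite sum1dep_card -card_block -mulnA.
  rewrite /rch; case: ltnP => [_|le]; last by rewrite !muln0 addn0.
  rewrite muln1; apply: leq_trans (leq_addl _ _); rewrite leq_mul2l /=.
  by apply: fam_card; apply: block_fam hF.
pose sh t Y := shatters (h + h) (block s F Y) (Tt t) (Vt t).
(* Sort these blocks by their coordinates on [Tt t], which gives at most [K^|T|] classes. A copy of
   [W :\: W1] within one class would extend to a copy in [F], so [C'] bounds each class. *)
have cGt t : t \in Th -> #|[set Y in G | sh t Y]| <= C' * K ^ a.-1.
  move=> tTh; have [TA /andP[W1T Ta] Vm bd] := hT t tTh.
  set T := Tt t in TA W1T Ta Vm bd *.
  have [e eT einj] : exists2 e : P -> I, (forall v, v \in W1 -> e v \in T) & {in W1 &, injective e}.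
    exists (fun v => nth i0 (enum T) (index v (enum W1))).
      move=> v vW; rewrite -mem_enum mem_nth // -cardE; apply: leq_trans W1T.
      by rewrite [leqRHS]cardE index_mem mem_enum.
    move=> u v uW vW /eqP; rewrite nth_uniq ?enum_uniq //; last first.
    - by rewrite -cardE; apply: leq_trans W1T; rewrite [leqRHS]cardE index_mem mem_enum.
    - by rewrite -cardE; apply: leq_trans W1T; rewrite [leqRHS]cardE index_mem mem_enum.
    by move/eqP/(congr1 (nth u (enum W1))); rewrite !nth_index ?mem_enum.
  set Gt := [set Y in G | _].
  have GtF' : Gt \subset F' by apply/subsetP => Y; rewrite !inE => /andP[/andP[]].
  have [g1 g2] := fam_sub GtF' hF'.
  pose res (Y : point) : point := [ffun i => if i \in T then Y i else ord0].
  have cres : #|res @: Gt| <= K ^ #|T|.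
    apply: fam_card; split=> [_ i /imsetP[Y YG ->] iT|_ _ i /imsetP[Y _ ->] /imsetP[Z _ ->] iT].
      by rewrite ffunE iT g1 // (subsetP TA).
    by rewrite !ffunE (negbTE iT).
  have cA : a.-1 = #|A :\: T|.-1 + #|T|.
    by rewrite cardsDS // -/a; move: Ta; rewrite -/a; lia.
  rewrite cA expnD mulnA; apply: leq_trans (leq_mul (leqnn _) cres).
  apply: card_le_fibres => y _; apply: bd; first split.
  - move=> Y i; rewrite in_set => /andP[YG _]; rewrite in_setD => /andP[_ iA]; exact: g1.
  - move=> Y Z i; rewrite in_set => /andP[YG /eqP Yy]; rewrite in_set => /andP[ZG /eqP Zy].
    rewrite in_setD negb_and negbK => /orP[iT|iA]; last exact: g2.
    by have := congr1 (fun u : point => u i) (etrans Yy (esym Zy)); rewrite !ffunE iT.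
  move=> cp; apply: ncopy; apply: (wcopy_extend (s := s) TA Vm eT einj _ _ cp).
    move=> Y Z i; rewrite in_set => /andP[_ /eqP Yy]; rewrite in_set => /andP[_ /eqP Zy] iT.
    by have := congr1 (fun u : point => u i) (etrans Yy (esym Zy)); rewrite !ffunE iT.
  by move=> Y; rewrite in_set => /andP[+ _]; rewrite in_set => /andP[].
(* Double counting of pairs of a rich block and a kind it realises, weighted by [wt]. *)
have cG : #|G| <= r * (C' * K ^ a.-1).
  rewrite -(leq_pmul2l Om0).
  apply: (@leq_trans (\sum_(Y in G) r * \sum_(t in Th) sh t Y * wt t)).
    rewrite mulnC -sum_nat_const; apply: leq_sum => Y; rewrite inE => /andP[_ rY].
    by apply: rich => //; apply: block_fam hF.
  rewrite -big_distrr /= exchange_big /= mulnCA leq_mul2l; apply/orP; right.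
  apply: leq_trans (leq_mul sumOm (leqnn _)); rewrite big_distrl /=; apply: leq_sum => t tTh.
  rewrite -big_distrl /= mulnC leq_mul2l; apply/orP; right.
  apply: leq_trans (cGt t tTh); rewrite -sum1_card [leqLHS]big_mkcond [leqRHS]big_mkcond /=.
  by apply: leq_sum => Y _; rewrite !inE; case: (Y \in F') => //=; case: (rch Y) => //=; case: sh.
have sK : s * K <= k + s by rewrite /K mulnS addnC leq_add2r mulnC leq_divM.
have pow : 2 * (s * K) ^ a.-1 <= 3 * k ^ a.-1.
  have small : 3 * (a.-1 * s) <= k by apply: leq_trans kge; nia.
  apply: leq_trans (expn_add_le small k0).
  by rewrite leq_mul2l; elim: (a.-1) => // m IHm; rewrite !expnS leq_mul.
rewrite expnMn in pow.
have sa : s ^ a = s * s ^ a.-1 by rewrite -expnS prednK.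
rewrite sa in cF; move: cF cF' cG pow C1.
set p := s ^ a.-1; set Q := K ^ a.-1; set kk := k ^ a.-1.
set f := #|F|; set f' := #|F'|; set g := #|G| => cF cF' cG pow C1.
have c1 : p * f' <= C * (p * Q) by rewrite mulnCA leq_mul2l cF' orbT.
have c2 : 6 * (2 * (s * p) * g) <= 2 * (C * (p * Q)).
  apply: leq_trans (_ : 6 * (2 * (s * p) * (r * (C' * Q))) <= _).
    by rewrite !leq_mul2l cG !orbT.
  have -> : 6 * (2 * (s * p) * (r * (C' * Q))) = 2 * ((6 * s * r * C') * (p * Q)).
    by rewrite !mulnA; lia.
  by rewrite leq_mul2l leq_mul2r C1 !orbT.
have c3 : C * (2 * (p * Q)) <= C * (3 * kk) by rewrite leq_mul2l pow orbT.
rewrite -(leq_pmul2l (ltn0Sn 11)).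
lia.
Qed.

End Copies.

(** * Iterating the recursion *)

Lemma sum_subset_expn (I : finType) (A : {set I}) (c : nat) :
  \sum_(T : {set I} | T \subset A) c ^ (#|A| - #|T|) = c.+1 ^ #|A|.
Proof.
move: {2}#|A| (erefl #|A|) => a; elim: a A => [|a IH] A.
  move/eqP; rewrite cards_eq0 => /eqP->; rewrite cards0 expn0.
  by rewrite (eq_bigl (pred1 set0)) ?big_pred1_eq // => T; rewrite subset0.
move=> cA; have [i iA] : exists i, i \in A by apply/set0Pn; rewrite -cards_eq0 cA.
have cA' : #|A :\ i| = a by have := cardsD1 i A; rewrite iA cA => -[].
have iA' : i \notin A :\ i by rewrite !inE eqxx.
rewrite -{1}(setD1K iA) sum_subset_setU1 // cA expnS -cA' -(IH _ cA') cA' mulSn [LHS]addnC.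
congr (_ + _); last first.
  rewrite big_distrr /=; apply: eq_bigr => T TA; rewrite subSn ?expnS //.
  by rewrite -cA' subset_leq_card.
apply: eq_bigr => T TA; rewrite cardsU1 (_ : i \notin T) ?add1n ?subSS //.
by apply: contra iA' => /(subsetP TA).
Qed.

(** An exponential-moment bound on a binomial tail: doubling [c] multiplies each term with
    [#|T| < t] by at least [2^(|A|-t)], and the full sum is then a binomial expansion. *)
Lemma sum_small_subsets (I : finType) (A : {set I}) (c t : nat) :
  2 ^ #|A| * \sum_(T : {set I} | (T \subset A) && (#|T| < t)) c ^ (#|A| - #|T|)
    <= 2 ^ t * (2 * c).+1 ^ #|A|.
Proof.
rewrite -(sum_subset_expn A (2 * c)) !big_distrr [leqRHS](bigID (fun T : {set I} => #|T| < t)) /=.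
apply: leq_trans (leq_addr _ _); apply: leq_sum => T /andP[TA Tt].
have le := subset_leq_card TA.
rewrite expnMn mulnA leq_mul2r; apply/orP; right.
by rewrite -expnD leq_pexp2l //; lia.
Qed.

(** By Bernoulli [(1 + 1/c)^(c+1)] is at least 2, so every [c + 1] units of exponent gain one factor
    2. *)
Lemma double_expn_le (c M a : nat) : 0 < c -> M * c.+1 <= a -> 2 ^ M * c ^ a <= c.+1 ^ a.
Proof.
move=> c0; have bern e : c ^ e * (c + e) <= c * c.+1 ^ e.
  elim: e => [|e IH]; first by rewrite !expn0; lia.
  rewrite !expnS; set p := c ^ e in IH *; set p' := c.+1 ^ e in IH *; nia.
have dbl : 2 * c ^ c.+1 <= c.+1 ^ c.+1.
  rewrite -(leq_pmul2l c0); apply: leq_trans (bern _); set p := c ^ c.+1; nia.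
elim: M a => [|M IH] a; first by move=> _; rewrite mul1n; elim: a => // a IHa; rewrite !expnS leq_mul. 
rewrite mulSn => le; rewrite -(subnKC (leq_trans (leq_addr _ _) le)).
set b := a - c.+1; have := IH b; rewrite !expnD expnS => {}IH.
have /IH : M * c.+1 <= b by rewrite /b; lia.
move/(leq_mul dbl); apply: leq_trans; rewrite mulnACA; lia.
Qed.

Section Iteration.
Variables (I : finType) (N : nat) (d : Order.disp_t) (P : finPOrderType d).
Variables (h : nat) (L : P -> nat).
Hypothesis L_mono : forall u w, (u < w)%O -> L u < L w.
Hypothesis L_lt : forall u, L u < h.
Hypothesis h_gt0 : 0 < h.

Notation point := {ffun I -> 'I_N.+1}.
Implicit Types (A T : {set I}) (W : {set P}) (B : {set point}).

Lemma bounded_leq A W C C' : C <= C' -> bounded N A W C -> bounded N A W C'.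
Proof.
by move=> CC' bd k F hF nc; apply: leq_trans (bd k F hF nc) _; rewrite leq_mul2r CC' orbT.
Qed.

(** The numerical hypothesis makes sets smaller than [#|W1|] contribute at most a quarter of
    [q^(a-1)] to the Sauer-Shelah sum, with [a = #|A|]. A rich block has more than half of [q^(a-1)]
    points, so larger sets contribute at least a quarter, a fraction [1/(4q)] of the total weight
    [q^a]. *)
Lemma bounded_stage_shatter A W W1 (q := h + h) C' C :
  0 < #|A| -> #|W1| < #|A| ->
  4 * q * 2 ^ #|W1| * (2 * q).-1 ^ #|A| <= (2 * q) ^ #|A| ->
  (forall T, T \subset A -> #|T| = #|W1| -> bounded N (A :\: T) (W :\: W1) C') ->
  24 * q * q * C' <= C -> 3 * q * #|A| <= C -> bounded N A W C.
Proof.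
move=> A0 W1A num bd C1 C2; have q1 : 1 < q by rewrite /q; lia.
have q0 : 0 < q by lia.
set a := #|A| in A0 W1A num C2; set t := #|W1| in W1A num bd.
pose m := q.-1; have qm : q = m.+1 by rewrite prednK.
(* A kind is weighted by the full shattered set [T], but only [t] of its coordinates are used up. *)
pose sub T : {set I} := [set x in take t (enum T)].
have subT T : sub T \subset T by apply/subsetP => x; rewrite inE => /mem_take; rewrite mem_enum.
have csub T : t <= #|T| -> #|sub T| = t.
  move=> tT; rewrite cardsE; have /card_uniqP -> : uniq (take t (enum T)).
    by rewrite take_uniq // enum_uniq.
  by rewrite size_takel // -cardE.
pose wt T := m ^ (a - #|T|).
have tail : 4 * \sum_(T : {set I} | (T \subset A) && (#|T| < t)) wt T <= q ^ a.-1.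
  have := sum_small_subsets A m t; rewrite -/a.
  set S := \sum_(T | _) _ => hS; rewrite -(leq_pmul2l q0) -expnS prednK //.
  have e : (2 * m).+1 = (2 * q).-1 by rewrite qm; lia.
  rewrite e in hS; rewrite expnMn in num.
  rewrite -(leq_pmul2l (expn_gt0 2 a : (0 < 2 ^ a))); apply: leq_trans num.
  apply: leq_trans (_ : 4 * q * (2 ^ a * S) <= _); first lia.
  by rewrite -[leqRHS]mulnA leq_mul2l hS orbT.
apply: (@bounded_stage I N d P h L L_mono L_lt A W W1 q (4 * q) (q ^ a) C' C {set I}
   [set T : {set I} | (T \subset A) && (t <= #|T|)] sub (fun _ _ => id) wt) => //.
- move=> T; rewrite inE => /andP[TA tT]; rewrite csub // leqnn W1A.
  by split=> //; [exact: subset_trans TA|move=> i c c' _ /andP[]|apply: bd; rewrite ?csub //; exact: subset_trans TA].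
- by rewrite expn_gt0 q0.
- rewrite qm -(sum_subset_expn A m) [leqRHS](bigID (fun T : {set I} => t <= #|T|)) /=.
  by rewrite (eq_bigl (fun T : {set I} => (T \subset A) && (t <= #|T|))) ?leq_addr // => T; rewrite inE.
- move=> B hB rB; have hB' : fam A m.+1 B by rewrite -qm.
  have := sauer_shelah hB'; rewrite -qm -/a => sauer.
  set S := \sum_(T in _) _.
  have : #|B| <= S + \sum_(T : {set I} | (T \subset A) && (#|T| < t)) wt T.
    apply: leq_trans sauer _; rewrite (bigID (fun T : {set I} => t <= #|T|)) /=.
    apply: leq_add.
      rewrite /S [leqRHS](eq_bigl (fun T : {set I} => (T \subset A) && (t <= #|T|))); last by move=> T; rewrite inE.
      apply: leq_sum => T _; rewrite leq_mul2r; apply/orP; right.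
      by have := @shatters_sub I N q B T (sub T) (fun=> id) (subT T); case: shatters => // ->.
    rewrite [leqLHS](eq_bigl (fun T : {set I} => (T \subset A) && (#|T| < t))); last by move=> T; rewrite ltnNge.
    by apply: leq_sum => T _; case: shatters; rewrite ?mul1n ?mul0n.
  have -> : q ^ a = q * q ^ a.-1 by rewrite -expnS prednK.
  have -> : 4 * q * S = q * (4 * S) by rewrite mulnCA mulnA.
  move: rB tail; rewrite -/a leq_mul2l => rB tail cB; apply/orP; right; lia.
- by apply: leq_trans C1; lia.
Qed.

Lemma sorted_val_enum (n : nat) (S : {set 'I_n}) : sorted ltn (map val (enum S)).
Proof.
apply: (subseq_sorted ltn_trans) (iota_ltn_sorted 0 n).
by rewrite -val_enum_ord map_subseq // enumT filter_subseq.
Qed.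

(** A kind is a coordinate together with a set of at least [q] values taken there. The side
    [2 * q^2] ensures [2 * q^a <= s^(a-1)] once [a >= 2], so a block with fewer than [q] values in
    every coordinate is poor. Every rich block thus realises some kind, and uniform weights
    suffice. *)
Lemma bounded_stage_coord A W v (q := h + h) (s := 2 * q ^ 2) C' C :
  1 < #|A| ->
  (forall i, i \in A -> bounded N (A :\ i) (W :\ v) C') ->
  6 * s * (#|I| * 2 ^ s) * C' <= C -> 3 * s * #|A| <= C -> bounded N A W C.
Proof.
move=> A1 bd C1 C2; have q1 : 1 < q by rewrite /q; lia.
have qs : q <= s by rewrite /s expnS expn1; nia.
set a := #|A| in A1 C2.
pose V (t : I * {set 'I_s}) (i : I) c := nth 0 (map val (enum t.2)) c.
have cX : #|{: I * {set 'I_s}}| = #|I| * 2 ^ s.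
  by rewrite card_prod; congr (_ * _); rewrite -cardsT -powersetT card_powerset cardsT card_ord.
apply: (@bounded_stage I N d P h L L_mono L_lt A W [set v] s (#|I| * 2 ^ s) (#|I| * 2 ^ s) C' C _
   [set t : I * {set 'I_s} | (t.1 \in A) && (q <= #|t.2|)] (fun t => [set t.1]) V (fun=> 1)) => //.
- by lia.
- move=> [i S]; rewrite inE /= => /andP[iA qS]; rewrite !cards1; split=> //.
  + by rewrite sub1set.
  + move=> j c c' _ /andP[cc' c'q]; rewrite /V /=.
    have := sorted_ltn_nth ltn_trans 0 (sorted_val_enum S).
    by move/(_ c c'); rewrite !inE size_map -cardE; apply=> //; apply: leq_trans qS => //; apply: ltn_trans cc' c'q.
  exact: bd.
- rewrite muln_gt0 expn_gt0 /= andbT; apply: leq_trans (max_card (mem A)); exact: ltnW.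
- by rewrite sum1_card -cX max_card.
- move=> B hB rB; rewrite leq_pmulr //.
  have [i iA qi] : exists2 i, i \in A & q <= #|[set x i | x : point in B]|.
    apply/exists_inP; apply: contraLR rB; rewrite negb_exists_in => /forall_inP small.
    rewrite -leqNgt; have [h1 h2] := hB.
    have cB : #|B| <= q ^ a.
      by apply: card_box h2 => i iA; have := small i iA; rewrite -ltnNge; apply: ltnW.
    apply: leq_trans (leq_mul (leqnn 2) cB) _.
    have -> : a = a.-2.+2 by lia.
    rewrite /s /= expnMn mulnC [leqRHS]mulnC -expnM leq_mul //.
      by rewrite leq_pexp2l //; lia.
    have -> : #|A|.-1 = a.-2.+1 by rewrite /a in A1 *; lia.
    by rewrite expnS leq_pmulr // expn_gt0.
  pose S := [set j : 'I_s | [exists x in B, val (x i) == val j]].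
  have qS : q <= #|S|.
    apply: leq_trans qi _; apply: leq_trans (leq_imset_card (fun j : 'I_s => inord j : 'I_N.+1) _).
    apply/subset_leq_card/subsetP => _ /imsetP[x xB ->]; have [h1 _] := hB.
    apply/imsetP; exists (Ordinal (h1 x i xB iA)); last by apply: val_inj; rewrite /= inordK.
    by rewrite inE; apply/exists_inP; exists x.
  rewrite (bigD1 (i, S)) /=; last by rewrite inE iA.
  suff -> : shatters q B [set i] (V (i, S)) by [].
  apply/shattersP => g; have gS : g i < size (enum S) by rewrite -cardE; apply: leq_trans qS.
  pose j := nth (Ordinal (leq_trans (ltnW q1) qs)) (enum S) (g i).
  have : j \in S by rewrite -mem_enum mem_nth.
  rewrite inE => /exists_inP[x xB /eqP xj]; exists x => // _ /set1P->.
  by rewrite /V /= (nth_map (Ordinal (leq_trans (ltnW q1) qs))).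
- exact: ltnW A1.
Qed.

(** Each round spends as many coordinates as it assigns elements, so [n + #|W| <= #|A|] persists and
    at least [n] coordinates stay active. The three terms of [D] cover the two requirements of a
    stage and the final chain bound. *)
Lemma bounded_large (n t : nat) (q := h + h) (D := 24 * q * q + 6 * q * n + 2 * h * n) j A W :
  0 < n -> #|I| = 2 * n -> q.+2 <= t -> 4 * q * t <= n ->
  #|W| <= j * t -> n + #|W| <= #|A| -> bounded N A W (D ^ j.+1).
Proof.
move=> n0 cI qt tn; have q0 : 0 < q by rewrite /q; lia.
have A2 A' : #|A'| <= 2 * n by rewrite -cI max_card.
have D0 : 0 < D by rewrite /D; nia.
have hD A' : h * #|A'| <= D by have := A2 A'; rewrite /D; nia.
have qD A' : 3 * q * #|A'| <= D by have := A2 A'; rewrite /D; nia.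
elim: j A W => [|j IH] A W.
  rewrite leqn0 cards_eq0 => /eqP-> nA; rewrite expn1.
  apply: bounded_leq (hD A) _; apply: bounded_chain L_mono L_lt _ _.
  by apply: leq_trans nA; apply: leq_trans n0 (leq_addr _ _).
move=> cW nA.
have [W1 W1W cW1] : exists2 W1 : {set P}, W1 \subset W & #|W1| = minn t #|W|.
  exists [set x in take (minn t #|W|) (enum W)].
    by apply/subsetP => x; rewrite inE => /mem_take; rewrite mem_enum.
  rewrite cardsE; have /card_uniqP -> : uniq (take (minn t #|W|) (enum W)).
    by rewrite take_uniq // enum_uniq.
  by rewrite size_takel // -cardE geq_minr.
have W1t : #|W1| <= t by rewrite cW1 geq_minl.
have W1le : #|W1| <= #|W| by rewrite cW1 geq_minr.
apply: (@bounded_stage_shatter A W W1 (D ^ j.+1)).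
- by lia.
- by lia.
(* The gain is [2^(2t)]: one [2^t] is the tail factor, the other absorbs [4 * q <= 2^(q+2)]. *)
- have c0 : 0 < (2 * q).-1 by lia.
  have := @double_expn_le (2 * q).-1 (2 * t) #|A| c0; rewrite prednK; last by lia.
  move=> dbl; apply: leq_trans (dbl _); last by lia.
  rewrite leq_mul2r; apply/orP; right.
  apply: leq_trans (_ : 2 ^ t * 2 ^ t <= _); last by rewrite -expnD addnn mul2n.
  apply: leq_mul; last by rewrite leq_pexp2l.
  apply: leq_trans (_ : 2 ^ (q.+2) <= _); last by rewrite leq_pexp2l.
  by rewrite !expnS; have := ltn_expl q (ltnSn 1); lia.
- move=> T TA cT; apply: IH.
    by rewrite cardsDS // cW1; move: cW; rewrite mulSn; lia.
  by rewrite !cardsDS // cT; lia.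
- by rewrite [leqRHS]expnS leq_mul2r; apply/orP; right; rewrite /D; lia.
- by apply: leq_trans (qD A) _; rewrite expnS leq_pmulr // expn_gt0 D0.
Qed.

(** One coordinate is spent per element; [#|W| < #|A|] leaves one for the final chain. *)
Lemma bounded_small (n : nat) (q := h + h) (s := 2 * q ^ 2)
    (D := 6 * s * (2 * n * 2 ^ s) + 6 * s * n + 2 * h * n) j A W :
  0 < n -> #|I| = 2 * n -> #|W| <= j -> #|W| < #|A| -> bounded N A W (D ^ j.+1).
Proof.
move=> n0 cI; have q0 : 0 < q by rewrite /q; lia.
have s0 : 0 < s by rewrite /s muln_gt0 expn_gt0 q0.
have A2 A' : #|A'| <= 2 * n by rewrite -cI max_card.
have D0 : 0 < D by rewrite /D; set z := 2 ^ s; clearbody z; nia.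
have hD A' : h * #|A'| <= D by have := A2 A'; rewrite /D; set z := 6 * s * _; nia.
have sD A' : 3 * s * #|A'| <= D by have := A2 A'; rewrite /D; set z := 6 * s * (_ * _); nia.
have chain A' j' : 0 < #|A'| -> bounded N A' (set0 : {set P}) (D ^ j'.+1).
  move=> A'0; apply: (@bounded_leq _ _ (h * #|A'|)); last exact: (bounded_chain L_mono L_lt).
  by apply: leq_trans (hD A') _; rewrite expnS leq_pmulr // expn_gt0 D0.
elim: j A W => [|j IH] A W.
  by rewrite leqn0 cards_eq0 => /eqP->; rewrite cards0; apply: chain.
have [->|[v vW]] := set_0Vmem W; first by rewrite cards0 => _; apply: chain.
have := cardsD1 v W; rewrite vW => cW Wj WA.
apply: (@bounded_stage_coord A W v (D ^ j.+1)).
- by lia.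
- move=> i iA; have := cardsD1 i A; rewrite iA => cA; apply: IH; lia.
- by rewrite cI -/q -/s [leqRHS]expnS leq_mul2r /D -addnA leq_addr orbT.
- by apply: leq_trans (sD A) _; rewrite expnS leq_pmulr // expn_gt0 D0.
Qed.

End Iteration.

(** * The rank function and the theorem *)

Definition rank (d : Order.disp_t) (P : finPOrderType d) (u : P) : nat :=
  \max_(A : {set P} | is_chain A && [forall x in A, (x < u)%O]) #|A|.

Lemma rankP (d : Order.disp_t) (P : finPOrderType d) (u : P) :
  exists A : {set P}, [/\ is_chain A, #|A| = (rank u).+1 & forall x, x \in A -> (x <= u)%O].
Proof.
have [|A /andP[cA /forall_inP Au] eA] :=
  @eq_bigmax_cond _ (fun A : {set P} => is_chain A && [forall x in A, (x < u)%O]) (fun A => #|A|).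
  apply/card_gt0P; exists set0; apply/andP; split.
    by apply/forall_inP => x; rewrite inE.
  by apply/forall_inP => x; rewrite inE.
have {}eA : rank u = #|A| := eA; rewrite eA; exists (u |: A); split.
- apply/forall_inP => x; rewrite in_setU1 => /orP[/eqP->|xA].
    apply/forall_inP => y; rewrite in_setU1 => /orP[/eqP->|yA]; first by rewrite lexx.
    by rewrite (ltW (Au y yA)) orbT.
  apply/forall_inP => y; rewrite in_setU1 => /orP[/eqP->|yA]; first by rewrite ltW ?Au.
  by have /forall_inP/(_ x xA)/forall_inP/(_ y yA) := cA.
- rewrite cardsU1 (_ : u \notin A) //; apply/negP => /Au; by rewrite ltxx.
- by move=> x; rewrite in_setU1 => /orP[/eqP->|/Au /ltW].
Qed.

Lemma rank_mono (d : Order.disp_t) (P : finPOrderType d) (u w : P) :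
  (u < w)%O -> rank u < rank w.
Proof.
move=> uw; have [A [cA <- Au]] := rankP u.
apply: (leq_bigmax_cond (F := fun A : {set P} => #|A|)); rewrite cA.
by apply/forall_inP => x /Au xu; apply: le_lt_trans uw.
Qed.

Lemma rank_height (d : Order.disp_t) (P : finPOrderType d) (u : P) : rank u < height P.
Proof.
have [A [cA <- _]] := rankP u.
exact: (leq_bigmax_cond (F := fun A : {set P} => #|A|)).
Qed.

(** With all coordinates active and all elements separated, a [wcopy] is an induced copy:
    monotonicity and separation give the two directions, antisymmetry gives injectivity. *)
Lemma bounded_copy (d : Order.disp_t) (P : finPOrderType d) (m N C : nat)
    (F : {set grid m N.+1}) :
  bounded N [set: 'I_m] [set: P] C -> ~ has_induced_copy P F -> #|F| <= C * N.+1 ^ (m - 1).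
Proof.
move=> bd nc; rewrite subn1; have := bd N.+1 F; rewrite cardsT card_ord; apply.
  by split=> [x i _ _|x y i _ _]; rewrite ?ltn_ord // inE.
case=> phi [phiF mono wit]; apply: nc; exists phi.
have iff x y : (x <= y)%O = grid_le (phi x) (phi y).
  apply/idP/forallP => [|le].
    rewrite le_eqVlt => /orP[/eqP->//|xy] i.
    by apply: ltnW; apply: mono.
  apply: contraT => /(wit x y (in_setT x))[i _]; by rewrite ltnNge le.
split=> // x y xy; apply/eqP; rewrite eq_le !iff xy.
by apply/andP; split; apply/forallP => i.
Qed.

Theorem theorem3p1 :
  forall h : nat, 0 < h ->
  exists c : nat,
    forall (d : Order.disp_t) (P : finPOrderType d),
      height P = h ->
      forall k : nat, 0 < k ->
      forall F : {set grid (2 * #|P|) k},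
        ~ has_induced_copy P F ->
        #|F| <= #|P| ^ c * k ^ (2 * #|P| - 1).
Proof.
move=> h h0; pose q := h + h; pose n0 := 4 * q * q.+2; pose s := 2 * q ^ 2.
pose E := 6 * s * (2 * n0 * 2 ^ s) + 6 * s * n0 + 2 * h * n0.
(* The first summand serves [n >= n0], where [n0] makes [n %/ (4 * q)] at least [q + 2]; the second
   serves [n < n0], with [E] the constant of [bounded_small] at [n0]. *)
exists (7 * (8 * q).+1 + E ^ n0.+1) => d P hP [//|N] _ F nc.
have L_lt (u : P) : rank u < h by rewrite -hP rank_height.
have L_mono := @rank_mono d P.
set n := #|P| in F nc *.
have n_gt0 : 0 < n.
  rewrite lt0n; apply: contraTneq h0 => n_eq0; rewrite -hP -leqNgt.
  by apply/bigmax_leqP => A _; rewrite -n_eq0 max_card.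
(* For [n = 1] the power of [n] is 1 and absorbs no constant, but then [F] is empty. *)
have [n1|n_neq1] := eqVneq n 1.
  have [->|[x xF]] := set_0Vmem F; first by rewrite cards0.
  case: nc; exists (fun=> x).
  have eqP1 (u v : P) : u = v by apply: fintype_le1P; rewrite -/n n1.
  split=> // u v; rewrite (eqP1 u v) lexx; apply/esym/forallP => i; exact: leqnn.
have n2 : 1 < n by lia.
have cI : #|'I_(2 * n)| = 2 * n by rewrite card_ord.
have cW : #|[set: P]| = n by rewrite cardsT.
have cA : #|[set: 'I_(2 * n)]| = 2 * n by rewrite cardsT card_ord.
apply: bounded_copy nc.
have [n_large|n_small] := leqP n0 n.
  pose t := n %/ (4 * q).
  have q4 : 0 < 4 * q by rewrite /q; lia.
  have qt : q.+2 <= t by rewrite leq_divRL // mulnC.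
  have tn : 4 * q * t <= n by rewrite mulnC leq_divM.
  (* Since [t >= 1], rounding down at most halves [n / (4q)], so [8 * q] rounds exhaust [P]. *)
  have nt : n <= 8 * q * t.
    have := ltn_ceil n q4; rewrite -/t mulSn.
    have : 4 * q * 1 <= 4 * q * t by rewrite leq_mul2l (leq_trans _ qt) ?orbT.
    lia.
  apply: bounded_leq (bounded_large L_mono L_lt h0 n_gt0 cI qt tn (j := 8 * q) _ _); last first.
  - by rewrite cW cA; lia.
  - by rewrite cW.
  rewrite -/q expnD; apply: leq_trans (leq_pmulr _ _); last by rewrite expn_gt0 n_gt0.
  rewrite expnM; set D := 24 * q * q + _ + _.
  have Dn : D <= n ^ 7.
    apply: leq_trans (_ : 32 * n ^ 2 <= _).
      have qn : q <= n.
        apply: leq_trans n_large; rewrite /n0 mulnAC.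
        by apply: leq_pmull; rewrite muln_gt0.
      have hn : h <= n by apply: leq_trans qn; rewrite /q leq_addr.
      have := leq_mul qn qn; have := leq_mul qn (leqnn n); have := leq_mul hn (leqnn n).
      rewrite /D expnS expn1; lia.
    rewrite (expnD n 5 2) leq_mul2r; apply/orP; right.
    by apply: leq_trans (_ : 2 ^ 5 <= _); rewrite ?leq_exp2r.
  by elim: ((8 * q).+1) => // m IHm; rewrite 2!(expnS _ m) leq_mul.
apply: bounded_leq (bounded_small L_mono L_lt h0 n_gt0 cI (j := n) _ _); last first.
- by rewrite cW cA; lia.
- by rewrite cW.
rewrite -/q -/s expnD; apply: leq_trans (leq_pmull _ _); last by rewrite expn_gt0 n_gt0.
set D := 6 * s * _ + _ + _.
have nn0 : n <= n0 by apply: ltnW.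
have DE : D <= E by rewrite /D /E; do 2?apply: leq_add; do ?apply: leq_mul.
have E0 : 0 < E by apply: leq_trans DE; rewrite /D; nia.
apply: leq_trans (_ : E ^ n0.+1 <= _).
  apply: leq_trans (_ : E ^ n.+1 <= _); first by rewrite leq_exp2r.
  by rewrite leq_pexp2l.
(* A constant [x] is at most [2^x], hence at most [n^x] as [n >= 2]. *)
apply: leq_trans (ltnW (ltn_expl _ (ltnSn 1))) _.
by case: (E ^ n0.+1) => // m; rewrite leq_exp2r.
Qed.
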